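(* Let $(b_n)_{n\ge1}$, $(c_n)_{n\ge0}$ be real sequences and define, for $n\ge1$, $$p_n=c_{n+4}c_{n+3}^2c_{n+2}^3b_{n+1}\left(c_n^2-b_{n+1}b_n\right),$$ $$\begin{aligned}q_n={}&-b_{n+2}b_{n+1}c_{n+3}^3c_{n+2}^2c_n^2+b_{n+1}^2c_{n+3}c_{n+2}^4b_{n+4}b_n-b_{n+2}b_{n+1}^2b_{n+3}c_{n+3}c_{n+2}^2b_{n+4}b_n\\&+b_{n+2}b_{n+1}b_{n+3}c_{n+3}c_{n+2}^2b_{n+4}c_n^2-b_{n+1}c_{n+3}c_{n+2}^4b_{n+4}c_n^2+b_{n+2}b_{n+1}^2c_{n+3}^3c_{n+2}^2b_n,\end{aligned}$$ $$\begin{aligned}r_n={}&-b_{n+2}b_{n+1}b_{n+3}^2c_{n+2}c_{n+1}b_{n+4}c_n^2-b_{n+1}^2c_{n+2}^3c_{n+1}b_{n+4}b_nb_{n+3}+b_{n+1}b_{n+3}c_{n+2}c_{n+1}^3c_{n+3}^2b_n\\&+b_{n+2}b_{n+1}b_{n+3}c_{n+2}c_{n+1}c_{n+3}^2c_n^2-b_{n+1}c_{n+2}c_{n+1}^3b_{n+4}b_nb_{n+3}^2+b_{n+1}^2c_{n+2}^3c_{n+1}c_{n+3}^2b_n\\&+b_{n+1}b_{n+3}c_{n+2}^3c_{n+1}b_{n+4}c_n^2+b_{n+3}^2c_{n+2}c_{n+1}^3b_{n+4}c_n^2-b_{n+1}c_{n+2}^3c_{n+1}c_{n+3}^2c_n^2\\&-b_{n+2}b_{n+1}^2b_{n+3}c_{n+2}c_{n+1}c_{n+3}^2b_n+b_{n+2}b_{n+1}^2c_{n+2}c_{n+1}b_{n+4}b_nb_{n+3}^2-b_{n+3}c_{n+2}c_{n+1}^3c_{n+3}^2c_n^2,\end{aligned}$$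 $$\begin{aligned}s_n={}&-b_{n+3}c_{n+1}^4c_nc_{n+3}^2b_n+b_{n+2}c_{n+1}^2c_n^3b_{n+4}b_{n+3}^2+b_{n+3}^2c_{n+1}^4c_nb_{n+4}b_n\\&+b_{n+2}b_{n+1}b_{n+3}c_{n+1}^2c_nc_{n+3}^2b_n-b_{n+2}b_{n+1}b_{n+3}^2c_{n+1}^2c_nb_{n+4}b_n-b_{n+2}c_{n+1}^2c_n^3c_{n+3}^2b_{n+3},\end{aligned}$$ $$t_n=b_{n+3}^2b_{n+4}c_{n+1}^3c_n^2c_{n-1}-b_{n+3}c_{n+3}^2c_{n+1}^3c_n^2c_{n-1},$$ and assume $p_n\neq0$ for all $n\ge1$. Let $(A_n)_{n\ge0}$, $(B_n)_{n\ge0}$ be two linearly independent rational-valued solutions of $$c_ny_{n+1}+c_{n-1}y_{n-1}-b_ny_n=0,\qquad n\ge1,$$ with $A_n>0$ and $B_n>0$ for all $n$, such that $\lim_{n\to\infty}B_n/A_n=L$ with $L\neq0$. Then $L$ is algebraic of degree at most $3$ over $\mathbb{Q}$ if and only if the five-term recurrence relation $$p_nz_{n+3}-q_nz_{n+2}-r_nz_{n+1}-s_nz_n-t_nz_{n-1}=0,\qquad n\ge1,$$ has a non-trivial rational-valued solution $(S_n)$ such that $$\frac{S_n}{A_{n+1}A_nA_{n-1}}\to0\quad(n\to\infty).$$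
   Formalization: The solution is indexed S_n = z_{n-1}, so the condition is z_{n-1}/(A_{n+1}A_nA_{n-1}) → 0. With S_n = z_n the claim is false: take A_n = 2^{-n^2}, B_n = β_n A_n with rational β_n strictly increasing to a transcendental L. *)

(* Defs.v *)
From mathcomp Require Import all_boot all_order all_algebra.
From mathcomp Require Import all_classical all_reals all_analysis.

Set Implicit Arguments.
Unset Strict Implicit.
Unset Printing Implicit Defensive.

Import Order.TTheory GRing.Theory Num.Theory.
Import numFieldNormedType.Exports.

Local Open Scope classical_set_scope.
Local Open Scope ring_scope.

(* The sequence (b_n) starts at n = 1: the value [b 0] is never used, because
   every formula below is only used for n >= 1. *)
Section Coefficients.
Variables (R : realType) (b c : nat -> R).
Implicit Type n : nat.

Definition coef_p n : R :=
  c n.+4 * c n.+3 ^+ 2 * c n.+2 ^+ 3 * b n.+1 * (c n ^+ 2 - b n.+1 * b n).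

Definition coef_q n : R :=
  - (b n.+2 * b n.+1 * c n.+3 ^+ 3 * c n.+2 ^+ 2 * c n ^+ 2)
  + b n.+1 ^+ 2 * c n.+3 * c n.+2 ^+ 4 * b n.+4 * b n
  - b n.+2 * b n.+1 ^+ 2 * b n.+3 * c n.+3 * c n.+2 ^+ 2 * b n.+4 * b n
  + b n.+2 * b n.+1 * b n.+3 * c n.+3 * c n.+2 ^+ 2 * b n.+4 * c n ^+ 2
  - b n.+1 * c n.+3 * c n.+2 ^+ 4 * b n.+4 * c n ^+ 2
  + b n.+2 * b n.+1 ^+ 2 * c n.+3 ^+ 3 * c n.+2 ^+ 2 * b n.

Definition coef_r n : R :=
  - (b n.+2 * b n.+1 * b n.+3 ^+ 2 * c n.+2 * c n.+1 * b n.+4 * c n ^+ 2)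
  - b n.+1 ^+ 2 * c n.+2 ^+ 3 * c n.+1 * b n.+4 * b n * b n.+3
  + b n.+1 * b n.+3 * c n.+2 * c n.+1 ^+ 3 * c n.+3 ^+ 2 * b n
  + b n.+2 * b n.+1 * b n.+3 * c n.+2 * c n.+1 * c n.+3 ^+ 2 * c n ^+ 2
  - b n.+1 * c n.+2 * c n.+1 ^+ 3 * b n.+4 * b n * b n.+3 ^+ 2
  + b n.+1 ^+ 2 * c n.+2 ^+ 3 * c n.+1 * c n.+3 ^+ 2 * b n
  + b n.+1 * b n.+3 * c n.+2 ^+ 3 * c n.+1 * b n.+4 * c n ^+ 2
  + b n.+3 ^+ 2 * c n.+2 * c n.+1 ^+ 3 * b n.+4 * c n ^+ 2
  - b n.+1 * c n.+2 ^+ 3 * c n.+1 * c n.+3 ^+ 2 * c n ^+ 2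
  - b n.+2 * b n.+1 ^+ 2 * b n.+3 * c n.+2 * c n.+1 * c n.+3 ^+ 2 * b n
  + b n.+2 * b n.+1 ^+ 2 * c n.+2 * c n.+1 * b n.+4 * b n * b n.+3 ^+ 2
  - b n.+3 * c n.+2 * c n.+1 ^+ 3 * c n.+3 ^+ 2 * c n ^+ 2.

Definition coef_s n : R :=
  - (b n.+3 * c n.+1 ^+ 4 * c n * c n.+3 ^+ 2 * b n)
  + b n.+2 * c n.+1 ^+ 2 * c n ^+ 3 * b n.+4 * b n.+3 ^+ 2
  + b n.+3 ^+ 2 * c n.+1 ^+ 4 * c n * b n.+4 * b n
  + b n.+2 * b n.+1 * b n.+3 * c n.+1 ^+ 2 * c n * c n.+3 ^+ 2 * b n
  - b n.+2 * b n.+1 * b n.+3 ^+ 2 * c n.+1 ^+ 2 * c n * b n.+4 * b n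
  - b n.+2 * c n.+1 ^+ 2 * c n ^+ 3 * c n.+3 ^+ 2 * b n.+3.

Definition coef_t n : R :=
  b n.+3 ^+ 2 * b n.+4 * c n.+1 ^+ 3 * c n ^+ 2 * c n.-1
  - b n.+3 * c n.+3 ^+ 2 * c n.+1 ^+ 3 * c n ^+ 2 * c n.-1.

Definition three_term_solution (y : nat -> rat) : Prop :=
  forall n, (1 <= n)%N ->
    c n * ratr (y n.+1) + c n.-1 * ratr (y n.-1) - b n * ratr (y n) = 0.

Definition five_term_solution (z : nat -> rat) : Prop :=
  forall n, (1 <= n)%N ->
    coef_p n * ratr (z n.+3) - coef_q n * ratr (z n.+2)
    - coef_r n * ratr (z n.+1) - coef_s n * ratr (z n)
    - coef_t n * ratr (z n.-1) = 0.

End Coefficients.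

Definition lin_indep_seq (R : realType) (A B : nat -> rat) : Prop :=
  forall u v : R, (forall n, u * ratr (A n) + v * ratr (B n) = 0) ->
    u = 0 /\ v = 0.

(* [p] below is the minimal polynomial of [x] over the rationals. *)
Definition algebraic_of_degree (R : realType) (x : R) (d : nat) : Prop :=
  exists p : {poly rat},
    [/\ p \is monic, irreducible_poly p, root (map_poly ratr p) x
      & size p = d.+1].

(* Indexing of solutions of the five-term recurrence.  A solution
   z_0, z_1, z_2, ... is listed as S_1, S_2, S_3, ..., i.e. S_n = z_(n-1):
   S_n / (A_(n+1) A_n A_(n-1)) only makes sense for n >= 1, and the products
   solving the recurrence are z_(n-1) = y_(n+1) y_n y_(n-1), for y a solution
   of the three-term recurrence.  With S_n = z_n the equivalence fails, e.g. for
   A_n = 2^(-n^2), B_n = beta_n A_n, beta_n increasing to a transcendental L. *)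
Definition listed_from_1 (z : nat -> rat) (n : nat) : rat := z n.-1.

(* Main.v *)
Require Import Defs.
From mathcomp Require Import all_boot all_order all_algebra.
From mathcomp Require Import all_classical all_reals all_analysis.
From mathcomp Require Import fieldext.
From mathcomp Require Import zify ring.

Import Order.TTheory GRing.Theory Num.Theory.
Import numFieldNormedType.Exports.

Local Open Scope classical_set_scope.
Local Open Scope ring_scope.

(* If y solves the three-term recurrence, then y_{k+2} y_{k+1} y_k solves the
   five-term one; polarising over y = u A + v B gives four solutions, whose
   quotients by A_{k+2} A_{k+1} A_k tend to 1, L, L^2, L^3.  When no c_k
   vanishes, the condition p_n <> 0 makes them a basis of the solution space
   over Q, so the rational solutions that are o(A_{k+2} A_{k+1} A_k) correspond
   to the rational polynomials of degree at most 3 vanishing at L.  The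
   condition leaves out only c_0, c_1, c_2; if one of these is 0, then B is
   eventually a rational multiple of A, so L is rational, while (1, 0, 0, ...)
   solves the five-term recurrence, so both sides of the equivalence hold. *)

(** * Products of three consecutive terms *)

Definition triple (y : nat -> rat) (k : nat) : rat :=
  y k.+2 * y k.+1 * y k.

Section FiveTerm.
Variables (R : realType) (b c : nat -> R).

Lemma five_term_solution_comb (u v : rat) (y z : nat -> rat) :
  five_term_solution b c y -> five_term_solution b c z ->
  five_term_solution b c (fun k => u * y k + v * z k).
Proof.
move=> soly solz n n1; have := soly n n1; have := solz n n1.
rewrite !rmorphD !rmorphM /= => hz hy.
have h0 (x w : R) : x = 0 -> w = 0 -> ratr u * x + ratr v * w = 0.
  by move=> -> ->; rewrite !mulr0 addr0.
by rewrite -[RHS](h0 _ _ hy hz); ring.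
Qed.

Lemma three_term_solution_comb (u v : rat) (y z : nat -> rat) :
  three_term_solution b c y -> three_term_solution b c z ->
  three_term_solution b c (fun k => u * y k + v * z k).
Proof.
move=> soly solz n n1; have := soly n n1; have := solz n n1.
rewrite !rmorphD !rmorphM /= => hz hy.
have h0 (x w : R) : x = 0 -> w = 0 -> ratr u * x + ratr v * w = 0.
  by move=> -> ->; rewrite !mulr0 addr0.
by rewrite -[RHS](h0 _ _ hy hz); ring.
Qed.

Lemma triple_five_term_solution (y : nat -> rat) :
  three_term_solution b c y -> five_term_solution b c (triple y).
Proof.
move=> soly [//|m] _; rewrite /triple.
have h1 := soly m.+1 isT; have h2 := soly m.+2 isT; have h3 := soly m.+3 isT.
have h4 := soly m.+4 isT; have h5 := soly m.+4.+1 isT.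
rewrite !rmorphM /coef_p /coef_q /coef_r /coef_s /coef_t /=.
move: h1 h2 h3 h4 h5 => /=.
move: (ratr (y m)) (ratr (y m.+1)) (ratr (y m.+2)) (ratr (y m.+3))
  (ratr (y m.+4)) (ratr (y m.+4.+1)) (ratr (y m.+4.+2)) => y0 y1 y2 y3 y4 y5 y6.
move: (c m) (c m.+1) (c m.+2) (c m.+3) (c m.+4) (c m.+4.+1)
  => c0 c1 c2 c3 c4 c5.
move: (b m.+1) (b m.+2) (b m.+3) (b m.+4) (b m.+4.+1) => b1 b2 b3 b4 b5.
move=> h1 h2 h3 h4 h5.
(* Each y_j, multiplied by enough c's, is a polynomial X_j in y2 and y3, and the
   coefficients p, ..., t supply exactly these factors: no division is needed,
   and the identity also holds where some c vanishes. *)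
set X4 := b3 * y3 - c2 * y2.
set X5 := b4 * X4 - c3 ^+ 2 * y3.
set X6 := b5 * X5 - c4 ^+ 2 * X4.
set X1 := b2 * y2 - c2 * y3.
set X0 := b1 * X1 - c1 ^+ 2 * y2.
have e4 : c3 * y4 = X4 by apply/eqP; rewrite -subr_eq0 /X4 -h3; apply/eqP; ring.
have e5 : c4 * c3 * y5 = X5.
  by transitivity (c3 * (c4 * y5 + c3 * y3 - b4 * y4)
    + (b4 * (c3 * y4) - c3 ^+ 2 * y3));
    [ring|rewrite h4 e4 /X5; ring].
have e6 : c5 * c4 * c3 * y6 = X6.
  by transitivity (c4 * c3 * (c5 * y6 + c4 * y4 - b5 * y5)
    + (b5 * (c4 * c3 * y5) - c4 ^+ 2 * (c3 * y4)));
    [ring|rewrite h5 e5 e4 /X6; ring].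
have e1 : c1 * y1 = X1 by apply/eqP; rewrite -subr_eq0 /X1 -h2; apply/eqP; ring.
have e0 : c1 * c0 * y0 = X0.
  by transitivity (c1 * (c1 * y2 + c0 * y0 - b1 * y1)
    + (b1 * (c1 * y1) - c1 ^+ 2 * y2));
    [ring|rewrite h1 e1 /X0; ring].
(* The five-term relation with the powers of [c] absorbed into the [X_j]: for instance c5 c4^2 c3^3
   y6 y5 y4 = X6 X5 X4. *)
transitivity (b2 * (c1 ^+ 2 - b2 * b1) * X6 * X5 * X4
  - (- (b3 * b2 * c4 ^+ 2 * c1 ^+ 2) + b2 ^+ 2 * c3 ^+ 2 * b5 * b1
     - b3 * b2 ^+ 2 * b4 * b5 * b1 + b3 * b2 * b4 * b5 * c1 ^+ 2
     - b2 * c3 ^+ 2 * b5 * c1 ^+ 2 + b3 * b2 ^+ 2 * c4 ^+ 2 * b1) * X5 * X4 * y3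
  - (- (b3 * b2 * b4 ^+ 2 * c2 * b5 * c1 ^+ 2)
     - b2 ^+ 2 * c3 ^+ 2 * c2 * b5 * b1 * b4
     + b2 * b4 * c2 ^+ 3 * c4 ^+ 2 * b1 + b3 * b2 * b4 * c2 * c4 ^+ 2 * c1 ^+ 2
     - b2 * c2 ^+ 3 * b5 * b1 * b4 ^+ 2 + b2 ^+ 2 * c3 ^+ 2 * c2 * c4 ^+ 2 * b1
     + b2 * b4 * c3 ^+ 2 * c2 * b5 * c1 ^+ 2 + b4 ^+ 2 * c2 ^+ 3 * b5 * c1 ^+ 2
     - b2 * c3 ^+ 2 * c2 * c4 ^+ 2 * c1 ^+ 2
     - b3 * b2 ^+ 2 * b4 * c2 * c4 ^+ 2 * b1
     + b3 * b2 ^+ 2 * c2 * b5 * b1 * b4 ^+ 2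
     - b4 * c2 ^+ 3 * c4 ^+ 2 * c1 ^+ 2) * X4 * y3 * y2
  - (- (b4 * c2 ^+ 4 * c4 ^+ 2 * b1) + b3 * c2 ^+ 2 * c1 ^+ 2 * b5 * b4 ^+ 2
     + b4 ^+ 2 * c2 ^+ 4 * b5 * b1 + b3 * b2 * b4 * c2 ^+ 2 * c4 ^+ 2 * b1
     - b3 * b2 * b4 ^+ 2 * c2 ^+ 2 * b5 * b1
     - b3 * c2 ^+ 2 * c1 ^+ 2 * c4 ^+ 2 * b4) * y3 * y2 * X1
  - (b4 ^+ 2 * b5 * c2 ^+ 3 - b4 * c4 ^+ 2 * c2 ^+ 3) * y2 * X1 * X0).
  by rewrite -e6 -e5 -e4 -e1 -e0; ring.
by rewrite /X0 /X6 /X5 /X4 /X1; ring.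
Qed.

End FiveTerm.

(** * Polarised products *)

(** Coefficient of u^(3-i) v^i in the triple product of u A + v B, divided by binomial(3, i), so
    that its quotient by the triple product of A tends to exactly L^i. *)
Definition mixed (A B : nat -> rat) (i k : nat) : rat :=
  match i with
  | 0 => A k.+2 * A k.+1 * A k
  | 1 => (B k.+2 * A k.+1 * A k + A k.+2 * B k.+1 * A k
          + A k.+2 * A k.+1 * B k) / 3
  | 2 => (A k.+2 * B k.+1 * B k + B k.+2 * A k.+1 * B k
          + B k.+2 * B k.+1 * A k) / 3
  | _ => B k.+2 * B k.+1 * B k
  end.

Definition mixed_comb (A B : nat -> rat) (p : {poly rat}) (k : nat) : rat :=
  \sum_(i < 4) p`_i * mixed A B i k.

Lemma triple_comb (A B : nat -> rat) (u v : rat) (k : nat) :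
  triple (fun j => u * A j + v * B j) k =
  u ^+ 3 * mixed A B 0 k + 3 * u ^+ 2 * v * mixed A B 1 k
  + 3 * u * v ^+ 2 * mixed A B 2 k + v ^+ 3 * mixed A B 3 k.
Proof. by rewrite /triple /mixed; field. Qed.

(** The triple products of A, B, A + B and A - B suffice: the difference of the last two is 6
    [mixed 1] + 2 [mixed 3], their sum 2 [mixed 0] + 6 [mixed 2]. *)
Lemma mixed_five_term_solution (R : realType) (b c : nat -> R)
    (A B : nat -> rat) (i : nat) :
  three_term_solution b c A -> three_term_solution b c B ->
  five_term_solution b c (mixed A B i).
Proof.
move=> solA solB.
have sol3 := triple_five_term_solution.
have solP := sol3 _ _ _ _ (three_term_solution_comb _ b c 1 1 _ _ solA solB).
have solN := sol3 _ _ _ _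
  (three_term_solution_comb _ b c 1 (-1) _ _ solA solB).
have comb := five_term_solution_comb _ b c.
have sol1 := comb 1 (- 2) _ _ (comb 1 (-1) _ _ solP solN) (sol3 _ _ _ _ solB).
have sol2 := comb 1 (- 2) _ _ (comb 1 1 _ _ solP solN) (sol3 _ _ _ _ solA).
case: i => [|[|[|i]]]; [exact: sol3| | |exact: (sol3 _ _ _ B)].
- have := comb (1 / 6) 0 _ _ sol1 sol1; congr five_term_solution.
  by apply/funext => k; rewrite !triple_comb /triple /mixed; field.
- have := comb (1 / 6) 0 _ _ sol2 sol2; congr five_term_solution.
  by apply/funext => k; rewrite !triple_comb /triple /mixed; field.
Qed.

Lemma mixed_comb_five_term_solution (R : realType) (b c : nat -> R)
    (A B : nat -> rat) (p : {poly rat}) :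
  three_term_solution b c A -> three_term_solution b c B ->
  five_term_solution b c (mixed_comb A B p).
Proof.
move=> solA solB; have sol i := mixed_five_term_solution _ _ _ _ _ i solA solB.
have comb := five_term_solution_comb _ b c.
have := comb 1 1 _ _ (comb p`_0 p`_1 _ _ (sol 0) (sol 1))
                     (comb p`_2 p`_3 _ _ (sol 2) (sol 3)).
congr five_term_solution; apply/funext => k.
by rewrite /mixed_comb !big_ord_recl big_ord0 /= /bump /=; ring.
Qed.

(** * Initial values and linear independence *)

(** As p_n is nonzero, the recurrence determines z_(n+3) from the four preceding terms. *)
Lemma five_term_solution_inj (R : realType) (b c : nat -> R)
    (y z : nat -> rat) :
  (forall n, (1 <= n)%N -> coef_p b c n <> 0) ->
  five_term_solution b c y -> five_term_solution b c z ->
  (forall k, (k < 4)%N -> y k = z k) -> y =1 z.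
Proof.
move=> p_neq0 soly solz yz k; have [m] := ubnP k.
elim: m k => // m IH k; have [k4 _|k4] := ltnP k 4; first exact: yz.
rewrite ltnS -(subnK k4) addn4; set n := (k - 4)%N => nm.
have := solz n.+1 isT; rewrite -(soly n.+1 isT) /=.
rewrite (IH n) ?(IH n.+1) ?(IH n.+2) ?(IH n.+3); try lia.
move=> h; apply: (fmorph_inj (ratr : rat -> R)).
apply: (mulfI (introN eqP (p_neq0 n.+1 isT))).
by move: h => /addIr /addIr /addIr /addIr ->.
Qed.

(** The 2x2 minor of (A, B) at j and k, a Casoratian when k = j + 1. As a function of one index it
    is a combination of A and B vanishing at the other. *)
Definition cross (A B : nat -> rat) (j k : nat) : rat := A j * B k - A k * B j.

Lemma crossC (A B : nat -> rat) (j k : nat) : cross A B j k = - cross A B k j.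
Proof. by rewrite /cross; ring. Qed.

(* [cross A B 0 2] is a multiple of [b 1], which may vanish. *)
Lemma triples_free (A B : nat -> rat) (w : nat -> rat) :
  (forall j k, (j < k <= j + 3)%N -> (j, k) != (0, 2)%N ->
    cross A B j k != 0) ->
  (forall u v, \sum_(k < 4) w k * triple (fun j => u * A j + v * B j) k = 0) ->
  forall k, (k < 4)%N -> w k = 0.
Proof.
move=> cross_neq0 w0.
have crossN j k : (k < j <= k + 3)%N -> (k, j) != (0, 2)%N ->
    cross A B j k != 0.
  by move=> kj kj02; rewrite crossC oppr_eq0 cross_neq0.
(* The solution u A + v B with (u, v) = (B_j, - A_j) vanishes at j; taking
   j = 2, 3, 4, 1 isolates w 3, w 0, w 1, w 2 in turn. *)
have wcross j : \sum_(k < 4) w k * triple (cross A B ^~ j) k = 0.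
  rewrite -[RHS](w0 (B j) (- A j)); apply: eq_bigr => k _.
  by rewrite /triple /cross; ring.
have crossjj j : cross A B j j = 0 by rewrite /cross subrr.
have cancel (x y1 y2 y3 : rat) : x * (y1 * y2 * y3) = 0 ->
    y1 != 0 -> y2 != 0 -> y3 != 0 -> x = 0.
  move=> + h1 h2 h3 => /eqP.
  by rewrite !mulf_eq0 (negPf h1) (negPf h2) (negPf h3) !orbF => /eqP.
(* A root at j kills the terms with k <= j <= k + 2: j = 2 leaves k = 3, j = 3 leaves k = 0, j = 4
   leaves k = 0, 1, and j = 1 leaves k = 2, 3. The pair (0, 2) never occurs. *)
have w3 : w 3 = 0.
  have := wcross 2; rewrite !big_ord_recl big_ord0 /= /bump /= /triple crossjj.
  rewrite !(mulr0, mul0r, add0r, addr0) => /cancel.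
  by apply; apply: crossN.
have w0' : w 0 = 0.
  have := wcross 3; rewrite !big_ord_recl big_ord0 /= /bump /= /triple crossjj.
  rewrite !(mulr0, mul0r, add0r, addr0) => /cancel.
  by apply; apply: cross_neq0.
have w1 : w 1 = 0.
  have := wcross 4; rewrite !big_ord_recl big_ord0 /= /bump /= /triple crossjj.
  rewrite w0' w3 !(mulr0, mul0r, add0r, addr0) => /cancel.
  by apply; apply: cross_neq0.
have w2 : w 2 = 0.
  have := wcross 1; rewrite !big_ord_recl big_ord0 /= /bump /= /triple crossjj.
  rewrite w0' w3 !(mulr0, mul0r, add0r, addr0) => /cancel.
  by apply; apply: crossN.
by move=> [|[|[|[|]]]].
Qed.

Definition mixed_matrix (A B : nat -> rat) : 'M[rat]_4 :=
  \matrix_(i, k) mixed A B i k.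

(** A vector orthogonal to all rows is, by [triple_comb], orthogonal to the initial values of every
    triple product of u A + v B, hence zero by [triples_free]. *)
Lemma mixed_matrix_unit (A B : nat -> rat) :
  (forall j k, (j < k <= j + 3)%N -> (j, k) != (0, 2)%N ->
    cross A B j k != 0) ->
  mixed_matrix A B \in unitmx.
Proof.
move=> cross_neq0; rewrite -unitmx_tr -row_free_unit; apply: inj_row_free => w.
move=> /rowP w0.
have w0' i : (i < 4)%N -> \sum_(k < 4) w 0 (inord k) * mixed A B i k = 0.
  move=> i4; have := w0 (inord i); rewrite !mxE => h; rewrite -[RHS]h.
  by apply: eq_bigr => k _; rewrite !mxE inord_val inordK.
apply/rowP => k; rewrite mxE -(inord_val k).
apply: (triples_free A B (fun k => w 0 (inord k)) cross_neq0) => // u v.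
pose F i := \sum_(k < 4) w 0 (inord k) * mixed A B i k.
transitivity (u ^+ 3 * F 0 + 3 * u ^+ 2 * v * F 1 + 3 * u * v ^+ 2 * F 2
  + v ^+ 3 * F 3); last by rewrite /F !w0' // !mulr0 !addr0.
rewrite /F !mulr_sumr -!big_split; apply: eq_bigr => i _.
by rewrite triple_comb /=; ring.
Qed.

Lemma mixed_combE (A B : nat -> rat) (v : 'rV[rat]_4) (k : 'I_4) :
  mixed_comb A B (rVpoly v) k = (v *m mixed_matrix A B) 0 k.
Proof. by rewrite mxE; apply: eq_bigr => i _; rewrite coef_rVpoly_ord mxE. Qed.

(** * Limits of the quotients *)

(** The quotient is a combination of normalised elementary symmetric polynomials in three
    consecutive ratios B/A, each tending to L. *)
Lemma cvg_mixed_comb (R : realType) (A B : nat -> rat) (L : R)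
    (p : {poly rat}) :
  (forall n, 0 < A n) ->
  (fun n => ratr (B n) / ratr (A n) : R) @ \oo --> L -> (size p <= 4)%N ->
  (fun k => ratr (mixed_comb A B p k) / ratr (triple A k) : R) @ \oo -->
    (map_poly ratr p).[L].
Proof.
move=> A_gt0 cvgL p4.
have A0 n : ratr (A n) != 0 :> R by rewrite fmorph_eq0 gt_eqF.
pose r (n : nat) : R := ratr (B n) / ratr (A n).
have cvg1 : r n.+1 @[n --> \oo] --> L by rewrite (cvg_shiftS r).
have cvg2 : r n.+2 @[n --> \oo] --> L by rewrite (cvg_shiftS (fun n => r n.+1)).
rewrite (@horner_coef_wide _ 4) ?size_map_poly //.
rewrite !big_ord_recl big_ord0 /= /bump /= !coef_map /=.
have -> : (fun k => ratr (mixed_comb A B p k) / ratr (triple A k) : R) =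
  (fun k => ratr p`_0 * 1 + (ratr p`_1 * ((r k.+2 + r k.+1 + r k) / 3) +
    (ratr p`_2 * ((r k.+1 * r k + r k.+2 * r k + r k.+2 * r k.+1) / 3) +
    (ratr p`_3 * (r k.+2 * r k.+1 * r k) + 0)))).
  apply/funext => k; rewrite /mixed_comb !big_ord_recl big_ord0 /= /bump /=.
  rewrite /mixed /triple /r !(rmorphD, rmorphM, fmorphV, rmorph0) /=.
  by rewrite ?ratr_nat; field; rewrite !A0.
have cvgr : r k @[k --> \oo] --> L := cvgL.
apply: cvgD; first by rewrite expr0; exact: cvg_cst.
apply: cvgD.
  have -> : L ^+ 1 = (L + L + L) / 3 by field.
  apply: cvgM; [exact: cvg_cst|apply: cvgM; last exact: cvg_cst].
  by apply: cvgD; [apply: cvgD|].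
apply: cvgD.
  have -> : L ^+ 2 = (L * L + L * L + L * L) / 3 by field.
  apply: cvgM; [exact: cvg_cst|apply: cvgM; last exact: cvg_cst].
  by apply: cvgD; [apply: cvgD|]; apply: cvgM.
apply: cvgD; last exact: cvg_cst.
apply: cvgM; first exact: cvg_cst.
by rewrite !exprSr expr0 mul1r; apply: cvgM => //; apply: cvgM.
Qed.

(** * Minimal polynomials *)

(** A nonzero annihilating polynomial of least size, made monic, is irreducible. *)
Lemma algebraic_of_degree_ltn_size (R : realType) (x : R) (p : {poly rat}) :
  p != 0 -> root (map_poly ratr p) x ->
  exists d, (d < size p)%N /\ algebraic_of_degree x d.
Proof.
move=> p0 px.
pose P n := `[< exists q : {poly rat},
  [/\ q != 0, root (map_poly ratr q) x & size q = n] >].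
have exP : exists n, P n by exists (size p); apply/asboolP; exists p.
case: (ex_minnP exP) => n /asboolP[q [q0 qx <-]] qmin.
have lc0 : (lead_coef q)^-1 != 0 by rewrite invr_eq0 lead_coef_eq0.
exists (size q).-1; have sq : (0 < size q)%N by rewrite size_poly_gt0.
rewrite prednK //; split; first by apply: qmin; apply/asboolP; exists p.
have rx : root (map_poly ratr ((lead_coef q)^-1 *: q)) x.
  by rewrite map_polyZ rootZ // fmorph_eq0.
exists ((lead_coef q)^-1 *: q); split => //.
- by rewrite monicE lead_coefZ mulVf // lead_coef_eq0.
- apply/(subfx_irreducibleP rx); first by rewrite scaler_eq0 negb_or lc0.
  move=> r hr r0; rewrite size_scale //; apply: qmin; apply/asboolP.
  by exists r.
- by rewrite size_scale // prednK.
Qed.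

Lemma algebraic_of_degree_ratr (R : realType) (q : rat) :
  algebraic_of_degree (ratr q : R) 1.
Proof.
exists ('X - q%:P); split; [exact: monicXsubC|exact: irredp_XsubC| |].
- by rewrite map_polyXsubC root_XsubC.
- exact: size_XsubC.
Qed.

(** * Non-vanishing of minors *)

(** The induction carries [c n * y n] = 0 rather than y_n = 0, which covers both a zero of y at m
    and a zero of c at m. *)
Lemma three_term_solution_eq0 (R : realType) (b c : nat -> R) (y : nat -> rat)
    (m : nat) :
  three_term_solution b c y -> (forall k, (m < k)%N -> c k != 0) ->
  c m * ratr (y m) = 0 -> y m.+1 = 0 -> forall n, (m < n)%N -> y n = 0.
Proof.
move=> soly c0 ym ym1 [//|n]; rewrite ltnS => mn.
suff [] : y n.+1 = 0 /\ c n * ratr (y n) = 0 by [].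
rewrite -(subnK mn); elim: (n - m)%N => {n mn} [|n [y0 cy0]]; first by [].
rewrite addSn; have /= := soly (n + m).+1 isT.
rewrite cy0 y0 rmorph0 !mulr0 subr0 addr0 => /eqP h; split => //.
apply/eqP; rewrite -(fmorph_eq0 (ratr : rat -> R)).
by move: h; rewrite mulf_eq0 (negPf (c0 _ _)) // ltnS leq_addl.
Qed.

Section Nonvanishing.
Variables (R : realType) (b c : nat -> R).
Hypothesis p_neq0 : forall n, (1 <= n)%N -> coef_p b c n <> 0.

Lemma coef_p_neq0 n : [/\ c n.+4.+1 != 0, c n.+4 != 0, c n.+3 != 0,
  b n.+2 != 0 & c n.+1 ^+ 2 - b n.+2 * b n.+1 != 0].
Proof.
by split; apply/eqP => h; apply: (p_neq0 n.+1 isT); rewrite /coef_p h; ring.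
Qed.

(** Up to nonzero factors c, the minors at distance 1 are all equal, and those at distances 2 and 3
    are the distance-1 minor times b_(j+1) and c_(j+1)^2 - b_(j+2) b_(j+1). These are factors of p,
    except for b_1. *)
Lemma cross_neq0 (A B : nat -> rat) :
  three_term_solution b c A -> three_term_solution b c B ->
  (forall k, c k != 0) -> cross A B 0 1 != 0 ->
  forall j k, (j < k <= j + 3)%N -> (j, k) != (0, 2)%N -> cross A B j k != 0.
Proof.
move=> solA solB c0 cross01.
pose D j k : R := ratr (cross A B j k).
have DE j k : D j k = ratr (A j) * ratr (B k) - ratr (A k) * ratr (B j).
  by rewrite /D /cross rmorphB !rmorphM.
have recA n :
    c n.+1 * ratr (A n.+2) = b n.+1 * ratr (A n.+1) - c n * ratr (A n).
  by apply/eqP; rewrite -subr_eq0 -(solA n.+1 isT) /=; apply/eqP; ring.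
have recB n :
    c n.+1 * ratr (B n.+2) = b n.+1 * ratr (B n.+1) - c n * ratr (B n).
  by apply/eqP; rewrite -subr_eq0 -(solB n.+1 isT) /=; apply/eqP; ring.
have Drec j n : c n.+1 * D j n.+2 = b n.+1 * D j n.+1 - c n * D j n.
  rewrite !DE mulrBr mulrCA recB [X in _ - X]mulrA recA; ring.
have Djj j : D j j = 0 by rewrite DE subrr.
have DC j k : D j k = - D k j by rewrite !DE; ring.
have D1 j : D j j.+1 != 0.
  elim: j => [|j IH]; first by rewrite fmorph_eq0.
  suff : c j.+1 * D j.+1 j.+2 != 0 by rewrite mulf_eq0 negb_or => /andP[].
  by rewrite Drec Djj mulr0 sub0r (DC j.+1) mulrN opprK mulf_neq0.
have D2 j : c j.+1 * D j j.+2 = b j.+1 * D j j.+1.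
  by rewrite Drec Djj mulr0 subr0.
have D3 j : c j.+1 * (c j.+2 * D j j.+3) =
    - (c j.+1 ^+ 2 - b j.+2 * b j.+1) * D j j.+1.
  rewrite Drec mulrBr mulrCA D2; ring.
have neq0 (x y : R) : x * y != 0 -> y != 0.
  by rewrite mulf_eq0 negb_or => /andP[].
move=> j k jk jk02; rewrite -(fmorph_eq0 (ratr : rat -> R)) -/(D j k).
have [|[|]] : k = j.+1 \/ k = j.+2 \/ k = j.+3 by lia.
- by move=> ->; exact: D1.
- move=> kE; case: j kE jk jk02 => [->//|j -> _ _].
  apply: (neq0 (c j.+2)); rewrite D2 mulf_neq0 //.
  by case: (coef_p_neq0 j).
- move=> ->; apply: (neq0 (c j.+2)); apply: (neq0 (c j.+1)).
  rewrite D3 mulf_neq0 // oppr_eq0; by case: (coef_p_neq0 j).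
Qed.

End Nonvanishing.

(** Otherwise A_0 B - B_0 A vanishes at 0 and 1, hence everywhere, a linear dependence. *)
Lemma lin_indep_cross01 (R : realType) (b c : nat -> R) (A B : nat -> rat) :
  three_term_solution b c A -> three_term_solution b c B ->
  lin_indep_seq R A B -> A 0 != 0 -> (forall k, c k != 0) ->
  cross A B 0 1 != 0.
Proof.
move=> solA solB indepAB A0 c0; apply/eqP => cross0.
pose y n := A 0 * B n + - B 0 * A n.
have y0 : y 0 = 0 by rewrite /y; ring.
have y1 : y 1 = 0 by rewrite -[RHS]cross0 /y /cross; ring.
have soly : three_term_solution b c y by exact: three_term_solution_comb.
have yn n : y n = 0.
  case: n => // n; apply: (three_term_solution_eq0 _ _ _ _ 0 soly) => //.
  by rewrite y0 rmorph0 mulr0.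
have [n|_] := indepAB (- ratr (B 0)) (ratr (A 0)).
  rewrite -[RHS](rmorph0 (ratr : rat -> R)) -(yn n) /y.
  by rewrite rmorphD !rmorphM rmorphN /= addrC.
by move/eqP; rewrite fmorph_eq0 (negPf A0).
Qed.

(** Substitute n = k + 1. *)
Lemma cvg_listed_from_1 (R : realType) (A z : nat -> rat) (l : R) :
  ((fun n => ratr (listed_from_1 z n) / ratr (A n.+1 * A n * A n.-1) : R)
    @ \oo --> l) =
  ((fun k => ratr (z k) / ratr (triple A k) : R) @ \oo --> l).
Proof. by rewrite -cvg_shiftS. Qed.

(** * The case where some c_m vanishes *)

(** Since c_m = 0 cuts off the earlier terms, B - q A vanishes from m + 1 on once it vanishes at m +
    1, so B/A is eventually constant. *)
Lemma degenerate_rational_limit (R : realType) (b c : nat -> R)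
    (A B : nat -> rat) (L : R) (m : nat) :
  three_term_solution b c A -> three_term_solution b c B ->
  (forall n, 0 < A n) ->
  (fun n => ratr (B n) / ratr (A n) : R) @ \oo --> L ->
  c m = 0 -> (forall k, (m < k)%N -> c k != 0) ->
  L = ratr (B m.+1 / A m.+1).
Proof.
move=> solA solB A_gt0 cvgL cm c0; set q := B m.+1 / A m.+1.
have A0 n : A n != 0 by rewrite gt_eqF.
have soly := three_term_solution_comb _ b c 1 (- q) _ _ solB solA.
have y0 : forall n, (m < n)%N -> 1 * B n + - q * A n = 0.
  apply: (three_term_solution_eq0 _ _ _ _ m soly) => //.
    by rewrite cm mul0r.
  by rewrite /q; field.
apply: (cvg_unique _ cvgL) => //.
apply: cvg_near_cst; exists m.+1 => // n /= mn.
have /eqP := y0 n mn; rewrite mul1r mulNr subr_eq0 => /eqP ->.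
by rewrite rmorphM mulfK // fmorph_eq0.
Qed.

(** z_0 enters only at n = 1, with coefficient t_1, a multiple of c_2^3 c_1^2 c_0. *)
Lemma five_term_solution_delta0 (R : realType) (b c : nat -> R) (m : nat) :
  (m <= 2)%N -> c m = 0 ->
  five_term_solution b c (fun n => (n == 0)%:R).
Proof.
move=> m2 cm [//|[|n]] _ /=; rewrite !rmorph0 !mulr0 !subr0 ?mulr0 //.
suff -> : coef_t b c 1 = 0 by rewrite mul0r subrr.
rewrite /coef_t.
by case: m m2 cm => [|[|[|//]]] _ cm; rewrite /= cm; ring.
Qed.

(** * The equivalence *)

Theorem theorem4p2 (R : realType) (b c : nat -> R)
  (p_neq0 : forall n, (1 <= n)%N -> coef_p b c n <> 0)
  (A B : nat -> rat)
  (solA : three_term_solution b c A)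
  (solB : three_term_solution b c B)
  (indepAB : lin_indep_seq R A B)
  (A_gt0 : forall n, 0 < A n)
  (B_gt0 : forall n, 0 < B n)
  (L : R)
  (limBA : (fun n : nat => ratr (B n) / ratr (A n) : R) @ \oo --> L)
  (L_neq0 : L <> 0) :
  (exists d : nat, (d <= 3)%N /\ algebraic_of_degree L d) <->
  (exists z : nat -> rat,
     five_term_solution b c z /\
     (exists n, z n <> 0) /\
     let S := listed_from_1 z in
     (fun n : nat => ratr (S n) / ratr (A n.+1 * A n * A n.-1) : R) @ \oo
       --> (0 : R)).
Proof.
have c3 k : (2 < k)%N -> c k != 0.
  by case: k => [|[|[|k]]] // _; case: (coef_p_neq0 _ _ _ p_neq0 k).
(* m is the last index where c vanishes, if there is one. *)
have [[m [m2 cm cgt]]|c0] : (exists m, [/\ (m <= 2)%N, c m = 0 &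
    forall k, (m < k)%N -> c k != 0]) \/ forall k, c k != 0.
- have [c20|c20] := eqVneq (c 2) 0; first by left; exists 2.
  have [c10|c10] := eqVneq (c 1) 0.
    by left; exists 1; split => // -[|[|[|k]]] // _; exact: c3.
  have [c00|c00] := eqVneq (c 0) 0.
    by left; exists 0; split => // -[|[|[|k]]] // _; exact: c3.
  by right=> -[|[|[|k]]] //; exact: c3.
- split=> _.
    exists (fun n => (n == 0)%:R); split.
      exact: (five_term_solution_delta0 _ _ _ m).
    split; first by exists 0; apply/eqP; rewrite oner_eq0.
    rewrite /= cvg_listed_from_1; apply: cvg_near_cst.
    by exists 1 => // -[|n] //= _; rewrite rmorph0 mul0r.
  exists 1; split => //.
  rewrite (degenerate_rational_limit _ _ _ _ _ _ m solA solB A_gt0 limBA) //.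
  exact: algebraic_of_degree_ratr.
have A0 : A 0 != 0 by rewrite gt_eqF.
have cr01 := lin_indep_cross01 _ _ _ _ _ solA solB indepAB A0 c0.
have Munit := mixed_matrix_unit _ _
  (cross_neq0 _ _ _ p_neq0 _ _ solA solB c0 cr01).
have cvgp (p : {poly rat}) := cvg_mixed_comb R A B L p A_gt0 limBA.
split=> [[d [d3 [p [_ pirr /rootP pL sp]]]]|[z [solz [[n zn]]]]].
- have p4 : (size p <= 4)%N by rewrite sp.
  exists (mixed_comb A B p); split.
    exact: mixed_comb_five_term_solution.
  split; last by rewrite /= cvg_listed_from_1 -pL; exact: cvgp.
  (* If the solution were zero, so would be its four initial values, and the invertible matrix would
     give p = 0. *)
  apply/not_existsP => z0; have /negP := irredp_neq0 pirr; apply.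
  rewrite -(poly_rV_K p4).
  suff -> : poly_rV p = 0 :> 'rV[rat]_4 by rewrite linear0.
  apply: (can_inj (mulmxK Munit)); rewrite mul0mx; apply/rowP => k.
  by rewrite -mixed_combE poly_rV_K // mxE; apply: contrapT (z0 k).
rewrite /= cvg_listed_from_1 => cvgz.
(* Coordinates of z in the basis of mixed products, read off from z_0, ..., z_3; they are the
   coefficients of the polynomial sought. *)
pose v : 'rV[rat]_4 := (\row_k z k) *m invmx (mixed_matrix A B).
have zE : mixed_comb A B (rVpoly v) = z.
  apply/funext; apply: (five_term_solution_inj _ _ _ _ _ p_neq0) => //.
    exact: mixed_comb_five_term_solution.
  move=> k k4; have := mixed_combE A B v (Ordinal k4).
  by rewrite mulmxKV // mxE.
have sv : (size (rVpoly v) <= 4)%N by exact: size_poly.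
have vL : root (map_poly ratr (rVpoly v)) L.
  apply/rootP; apply: cvg_unique (cvgp _ sv) _ => //.
  by rewrite zE.
have v0 : rVpoly v != 0.
  apply: contra_notN zn => /eqP v0; rewrite -zE v0 /mixed_comb big1 // => i _.
  by rewrite coef0 mul0r.
have [d [dlt dL]] := algebraic_of_degree_ltn_size _ _ _ v0 vL.
by exists d; split => //; rewrite -ltnS (leq_trans dlt).
Qed.
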